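(* Let $f\in L^1[0,1]$ and $\gamma>0$. Then the continuous $L^1$-Potts functional $P_\gamma$ of $f$ has a minimizer, i.e., there is $u^\ast\in L^1[0,1]$ with $P_\gamma(u^\ast)=\inf_{v\in L^1[0,1]}P_\gamma(v)$.
   Context: $\mathrm{PC}[0,1]\subset L^1[0,1]$ is the set of (equivalence classes of) piecewise constant functions on $[0,1]$ with finitely many jumps; for $u\in \mathrm{PC}[0,1]$, $J(u)$ is the number of jumps of $u$ in $(0,1)$, i.e. the number of points in the support of its distributional derivative. The continuous $L^1$-Potts functional is $P_\gamma:L^1[0,1]\to[0,\infty]$, $P_\gamma(u)=\gamma J(u)+\|u-f\|_1$ if $u\in\mathrm{PC}[0,1]$ and $P_\gamma(u)=\infty$ otherwise. *)

(* Defs.v *)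
From mathcomp Require Import all_boot all_order all_algebra.
From mathcomp Require Import all_classical all_reals all_analysis.

Set Implicit Arguments.
Unset Strict Implicit.
Unset Printing Implicit Defensive.

Import Order.TTheory GRing.Theory Num.Theory.
Import numFieldNormedType.Exports.

Local Open Scope classical_set_scope.
Local Open Scope ring_scope.

(* The measure space [0,1], carried by the whole real line: Lebesgue measure
   restricted to [0,1], for which the complement of [0,1] is negligible. *)
Definition leb01 (R : realType) : {measure set (measurableTypeR R) -> \bar R} :=
  mrestr (@lebesgue_measure R) (measurable_itv `[0, 1]).

(* Elements are classes of measurable functions modulo leb01-a.e. equality;
   one is coerced to a function by choosing a representative. *)
Definition L1 (R : realType) := LspaceType1 (leb01 R).

(* The values at the breakpoints are arbitrary. *)
Definition piecewise_constant (R : realType) (g : R -> R) : Prop :=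
  exists2 s : seq R, itv_partition 0 1 s &
    forall i, (i < size s)%N ->
      exists c : R, forall x, nth 0 (0 :: s) i < x < nth 0 s i -> g x = c.

Definition PC (R : realType) (u : L1 R) : Prop :=
  exists2 g : R -> R, piecewise_constant g & u = g %[ae leb01 R].

(* The jumps of a class u in PC[0,1], i.e. the support of its distributional
   derivative on ]0,1[: the points on the two sides of which u is a.e. equal to
   two different constants.  Being stated a.e., this does not depend on the
   representative, and a breakpoint that separates equal constants is not
   counted.  Outside PC[0,1] this set is not meaningful; potts does not use it
   there. *)
Definition jump_set (R : realType) (u : L1 R) : set R :=
  [set x | 0 < x < 1 /\ exists (a b : R), a != b /\ exists2 e : R, 0 < e &
     {ae leb01 R, forall y, x - e < y < x -> u y = a} /\
     {ae leb01 R, forall y, x < y < x + e -> u y = b}].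

Definition J (R : realType) (u : L1 R) : \bar R := counting (jump_set u).

Local Open Scope ereal_scope.

Definition potts (R : realType) (gamma : R) (f u : L1 R) : \bar R :=
  if `[< PC u >]
  then gamma%:E * J u + 'N[leb01 R]_1[EFin \o (u \- f)%R]
  else +oo.

(* Main.v *)
(* The difficulty is that the values of a minimizing sequence may blow up on
   intervals that shrink to a point.  So only the positions of the breakpoints
   are kept as variables: on each interval the best constant (a median of f)
   exists and is plugged in.  The resulting error on ]s, t[ is lower
   semicontinuous in (s, t), because on intervals close to a nondegenerate one
   the best constants are bounded in terms of the norm of f, and because the
   error on a degenerate interval is 0.  For a fixed number k of breakpoints the
   total error thus has a minimum on the compact simplex of nondecreasing
   k-tuples, and the penalty gamma * k makes the minimum over k attained.  In an
   optimal configuration no two breakpoints coincide. *)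

From HB Require Import structures.
Require Import Defs.
From mathcomp Require Import all_boot all_order all_algebra finmap.
From mathcomp Require Import all_classical all_reals all_analysis.
From mathcomp Require Import measurable_realfun lra.

Set Implicit Arguments.
Unset Strict Implicit.
Unset Printing Implicit Defensive.

Import Order.TTheory GRing.Theory Num.Theory.
Import numFieldNormedType.Exports.

Local Open Scope classical_set_scope.
Local Open Scope ring_scope.

(** * Best approximation by a constant *)

Section deviation.
Context d (T : measurableType d) (R : realType).
Variable mu : {measure set T -> \bar R}.
Hypothesis mu_fin : (mu setT < +oo)%E.
Variable f : T -> R.
Hypothesis f_int : mu.-integrable setT (EFin \o f).
Implicit Types (A B : set T) (c : R).

Definition dev A c := \int[mu]_(x in A) `|f x - c|.

(** Best constants need not be unique, so one is chosen. By [exists_best], the default 0 is never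
    reached for measurable [A]. *)
Definition best A := xget 0 [set c | forall c', dev A c <= dev A c'].

Definition mindev A := dev A (best A).

Lemma measure_fin A : measurable A -> (mu A < +oo)%E.
Proof.
by move=> mA; apply: le_lt_trans mu_fin; apply: le_measure; rewrite ?inE.
Qed.

Lemma integrable_const A c : measurable A -> mu.-integrable A (EFin \o cst c).
Proof.
move=> mA; apply: measurable_bounded_integrable => //; first exact: measure_fin.
by exists `|c|; split; [exact: num_real|move=> M cM x Ax /=; exact: ltW].
Qed.

Lemma integrable_dev A c : measurable A ->
  mu.-integrable A (EFin \o (fun x => `|f x - c|)).
Proof.
move=> mA.
have : mu.-integrable A (EFin \o (f \- cst c)).
  have := integrableB mA (integrableS measurableT mA (@subsetT _ A) f_int)
    (integrable_const c mA).
  by apply: eq_integrable => // x _; rewrite /= EFinB.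
by move/integrable_norm; apply: eq_integrable.
Qed.

Lemma integrable_norm_add A c : measurable A ->
  mu.-integrable A (EFin \o (fun x => `|f x| + c)).
Proof.
move=> mA.
have := integrableD mA (integrable_dev 0 mA) (integrable_const c mA).
by apply: eq_integrable => // x _; rewrite /= subr0 EFinD.
Qed.

Lemma dev_ge0 A c : 0 <= dev A c.
Proof. by apply: Rintegral_ge0 => x _. Qed.

Lemma dev_lipschitz A c c' : measurable A ->
  dev A c <= dev A c' + `|c - c'| * fine (mu A).
Proof.
move=> mA; rewrite -Rintegral_cst// -RintegralD//; last 2 first.
- exact: integrable_dev.
- exact: integrable_const.
apply: le_Rintegral => //; first exact: integrable_dev.
- have := integrableD mA (integrable_dev c' mA) (integrable_const `|c - c'| mA).
  by apply: eq_integrable => // x _; rewrite /= EFinD.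
- move=> x _; rewrite distrC -[X in X <= _](_ : `|(f x - c') + (c' - c)| = _).
    by rewrite (distrC c); exact: ler_normD.
  by rewrite distrC addrA subrK.
Qed.

(** Integrate |c| <= |f - c| + |f| over [A]. A constant with a small error is thus bounded once [A]
    has positive measure. *)
Lemma dev_coercive A c : measurable A ->
  `|c| * fine (mu A) <= dev A c + dev A 0.
Proof.
move=> mA; rewrite -Rintegral_cst// -RintegralD//; last 2 first.
- exact: integrable_dev.
- exact: integrable_dev.
apply: le_Rintegral => //; first exact: integrable_const.
- have := integrableD mA (integrable_dev c mA) (integrable_dev 0 mA).
  by apply: eq_integrable => // x _; rewrite /= EFinD.
- move=> x _; rewrite subr0 [ `|f x - c|]distrC.
  by rewrite -[X in `|X| <= _](subrK (f x) c); exact: ler_normD.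
Qed.

(** Split [A] into its parts inside and outside [B], then enlarge the inner part to [B]. *)
Lemma dev_setD A B c : measurable A -> measurable B ->
  dev A c <= dev B c + \int[mu]_(x in A `\` B) `|f x - c|.
Proof.
move=> mA mB; have mAB : measurable (A `&` B) by exact: measurableI.
have mADB : measurable (A `\` B) by exact: measurableD.
have dE : dev A c = dev (A `&` B) c + \int[mu]_(x in A `\` B) `|f x - c|.
  rewrite /dev -{1}(setUIDK A B) Rintegral_setU//.
    by rewrite setUIDK; exact: integrable_dev.
  apply/disj_setPS => x [] [_ Bx] [_]; exact.
rewrite dE lerD2r /dev /Rintegral fine_le//.
- exact/integrable_fin_num/integrable_dev.
- exact/integrable_fin_num/integrable_dev.
apply: ge0_subset_integral => //; first exact: measurable_int (integrable_dev c mB).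
Qed.

(** On a null set [dev A] is constant. Otherwise it is Lipschitz in the constant, and by coercivity
    every constant beyond [M] in absolute value is worse than 0, so the extreme value theorem on
    [-M, M] suffices. *)
Lemma exists_best A : measurable A -> exists c, forall c', dev A c <= dev A c'.
Proof.
move=> mA.
have := fine_ge0 (measure_ge0 mu A); rewrite le_eqVlt => /predU1P[m0|m0].
  by exists 0 => c'; have := dev_lipschitz 0 c' mA; rewrite -m0 mulr0 addr0.
set m := fine (mu A) in m0.
pose M := 2 * dev A 0 / m.
have M0 : 0 <= M by rewrite divr_ge0 ?(ltW m0)// mulr_ge0// dev_ge0.
have cont : {within `[- M, M], continuous (dev A)}.
  apply: continuous_subspaceT => c; apply/cvgrPdist_lt => /= e e0.
  near=> c'.
  have cc' : `|c - c'| * m < e.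
    rewrite -ltr_pdivlMr//; near: c'.
    by apply: cvgr_dist_lt; [exact: cvg_id|rewrite divr_gt0].
  rewrite ltr_distl; have := dev_lipschitz c c' mA.
  have := dev_lipschitz c' c mA; rewrite (distrC c') -/m => h1 h2.
  by apply/andP; split; lra.
have [|c _ cmin] := EVT_min _ cont; first by rewrite ge0_cp.
exists c => c'.
have [c'M|c'M] := leP `|c'| M; first by apply: cmin; rewrite in_itv/= -ler_norml.
apply: (@le_trans _ _ (dev A 0)).
  by apply: cmin; rewrite in_itv/= M0 oppr_le0 M0.
have := dev_coercive c' mA; rewrite -/m.
move: c'M; rewrite /M ltr_pdivrMr// => h1 h2; lra.
Unshelve. all: by end_near. Qed.

Lemma mindev_le A c : measurable A -> mindev A <= dev A c.
Proof.
by move=> mA; rewrite /mindev /best; case: xgetP => [c0 ->|] //;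
  have [c0 h] := exists_best mA; move=> /(_ c0).
Qed.

Lemma mindev_ge0 A : 0 <= mindev A.
Proof. exact: dev_ge0. Qed.

Lemma mindev_set0 : mindev set0 = 0.
Proof. by rewrite /mindev /dev Rintegral_set0. Qed.

(* The best constant c for B satisfies |c| mu(Q) <= |c| mu(B) <= 2 ||f||. *)
Lemma mindev_setD A B Q : measurable A -> measurable B -> measurable Q ->
  Q `<=` B -> 0 < fine (mu Q) ->
  mindev A <= mindev B +
    \int[mu]_(x in A `\` B) (`|f x| + 2 * dev setT 0 / fine (mu Q)).
Proof.
move=> mA mB mQ QB Q0; set c := best B.
have cK : `|c| <= 2 * dev setT 0 / fine (mu Q).
  have dT : dev B 0 <= dev setT 0.
    have := dev_setD 0 mB measurableT.
    by rewrite setDT Rintegral_set0 addr0.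
  rewrite ler_pdivlMr//; apply: (@le_trans _ _ (`|c| * fine (mu B))).
    rewrite ler_wpM2l// fine_le//.
    - by rewrite ge0_fin_numE// measure_fin.
    - by rewrite ge0_fin_numE// measure_fin.
    - by apply: le_measure; rewrite ?inE.
  have := dev_coercive c mB; have := mindev_le 0 mB.
  by rewrite -/(mindev B) => h1 h2; lra.
apply: (le_trans (mindev_le c mA)); apply: (le_trans (dev_setD c mA mB)).
have mAB : measurable (A `\` B) by exact: measurableD.
rewrite lerD2l; apply: le_Rintegral => //.
- exact: integrable_dev.
- exact: integrable_norm_add.
- by move=> x _; apply: (le_trans (ler_normB _ _)); rewrite lerD2l.
Qed.

End deviation.

(** By monotone convergence, some compact interval [F n] inside ]a, b[ carries all but [e] of the
    integral. An interval ]a', b'[ whose ends are off by less than [rr n] contains [F n], so what it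
    misses of ]a, b[ has integral below [e]. *)
Lemma integral_itv_shrink (R : realType)
    (mu : {measure set (measurableTypeR R) -> \bar R}) (w : R -> R) (a b e : R) :
  mu.-integrable `]a, b[ (EFin \o w) -> (forall x, 0 <= w x) -> 0 < e ->
  exists2 r : R, 0 < r & forall a' b', a' < a + r -> b - r < b' ->
    \int[mu]_(x in `]a, b[ `\` `]a', b'[) w x < e.
Proof.
move=> wint w0 e0.
have mab (x y : R) : measurable (`]x, y[%classic : set (measurableTypeR R)) by [].
pose rr (n : nat) : R := n.+1%:R^-1.
have r0 n : 0 < rr n by rewrite invr_gt0.
pose F (n : nat) : set R :=
  `[a + rr n, b - rr n]%classic.
have mF n : measurable (F n : set (measurableTypeR R)) by exact: measurable_itv.
have Fab n : F n `<=` `]a, b[.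
  move=> x; rewrite /F /= !in_itv/= => /andP[h1 h2].
  by have r0n := r0 n; apply/andP; split; lra.
have UF : \bigcup_n F n = `]a, b[%classic.
  apply/seteqP; split => [x [n _]|x]; first exact: Fab.
  rewrite /= in_itv/= => /andP[ax xb].
  have m0 : 0 < Num.min (x - a) (b - x) by rewrite lt_min !subr_gt0 ax.
  have [n nm] := ltr_add_invr m0.
  rewrite -/(rr n) in nm; exists n => //; rewrite /F /= in_itv/=.
  by move: nm; rewrite add0r lt_min => /andP[h1 h2]; apply/andP; split; lra.
have ndF : nondecreasing_seq F.
  move=> m n mn; apply/subsetPset => x; rewrite /F /= !in_itv/= => /andP[h1 h2].
  have : rr n <= rr m by rewrite lef_pV2 ?posrE// ler_nat.
  by move=> h; apply/andP; split; lra.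
have mw := measurable_int mu wint.
have wcvg : (\int[mu]_(x in F n) (w x)%:E)%E @[n --> \oo] -->
    (\int[mu]_(x in `]a, b[) (w x)%:E)%E.
  rewrite -UF; apply: ge0_nondecreasing_set_cvg_integral => //.
  - by move=> n; apply: measurable_funS mw.
  - by move=> n x _; rewrite lee_fin.
have wcvgR : \int[mu]_(x in F n) w x @[n --> \oo] --> \int[mu]_(x in `]a, b[) w x.
  by apply: fine_cvg; rewrite fineK//; exact: integrable_fin_num.
have [n _ /(_ n (leqnn n))] : \forall n \near \oo,
    \int[mu]_(x in `]a, b[) w x - e < \int[mu]_(x in F n) w x.
  by apply: cvgr_gt wcvgR _ _; rewrite gtrBl.
rewrite /= ltrBlDr => hn.
exists (rr n); first exact: r0.
move=> a' b' a'a bb'; set D := _ `\` _.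
have mD : measurable D by exact: measurableD.
have DF : [disjoint D & F n].
  apply/disj_setPS => x [] [_]; rewrite /F /= !in_itv/= => + /andP[h1 h2]; apply.
  by apply/andP; split; lra.
have DFab : D `|` F n `<=` `]a, b[.
  by rewrite subUset; split; [exact: subDsetl|exact: Fab].
have DFint : mu.-integrable (D `|` F n) (EFin \o w).
  by apply: integrableS wint => //; exact: measurableU.
have : \int[mu]_(x in D `|` F n) w x <= \int[mu]_(x in `]a, b[) w x.
  rewrite /Rintegral fine_le//.
  - by apply: integrable_fin_num => //; exact: measurableU.
  - exact: integrable_fin_num.
  - apply: ge0_subset_integral => //; first exact: measurableU.
    by move=> x _; rewrite lee_fin.
by rewrite Rintegral_setU// => h; lra.
Qed.

(** * Null sets and intervals for Lebesgue measure on [0,1] *)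

Section leb01.
Variable R : realType.
Local Notation mu := (leb01 R).

Lemma leb01E (A : set R) : mu A = lebesgue_measure (A `&` `[0, 1]).
Proof. by []. Qed.

Lemma leb01_fin : (mu setT < +oo)%E.
Proof. by rewrite leb01E setTI lebesgue_measure_itv/= lte_fin ltr01 ltry. Qed.

Lemma leb01_itvoo (a b : R) : 0 <= a -> a < b -> b <= 1 ->
  mu `]a, b[%classic = (b - a)%:E.
Proof.
move=> a0 ab b1; rewrite leb01E setIidl.
  by rewrite lebesgue_measure_itv/= lte_fin ab EFinB.
move=> x /=; rewrite !in_itv/= => /andP[h1 h2]; apply/andP; split; lra.
Qed.

Lemma leb01_set1 (a : R) : mu [set a] = 0%E.
Proof.
apply/eqP; rewrite eq_le measure_ge0 andbT leb01E.
rewrite -(lebesgue_measure_set1 a); apply: le_measure; rewrite ?inE//.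
by apply: measurableI.
Qed.

(** Such a set meets [0,1] in the endpoints at most. *)
Lemma leb01_out (A : set R) : measurable A -> A `&` `]0, 1[ = set0 -> mu A = 0%E.
Proof.
move=> mA A01.
have : A `&` `[0, 1] `<=` [set 0] `|` [set 1].
  move=> x [Ax]; rewrite /= in_itv/= => /andP[x0 x1].
  have [->|xn0] := eqVneq x 0; first by left.
  have [->|xn1] := eqVneq x 1; first by right.
  suff : set0 x by [].
  rewrite -A01; split => //=.
  by rewrite in_itv/= lt_neqAle eq_sym xn0 x0 lt_neqAle xn1.
move=> sub; apply/eqP; rewrite eq_le measure_ge0 andbT leb01E.
apply: (@le_trans _ _ (lebesgue_measure ([set 0] `|` [set 1 : R]))).
  apply: le_measure => //; rewrite inE; first exact: measurableI.
  exact: measurableU.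
apply: (le_trans (measureU2 _ _ _)) => //.
rewrite (_ : _ + _ = 0)%E//.
have h := @lebesgue_measure_set1 R; rewrite /= in h.
by rewrite -[RHS]adde0; congr (_ + _)%E; exact: h.
Qed.

End leb01.

(** * Lower semicontinuity of the best error in the endpoints *)

Section lower_semicontinuity.
Variables (R : realType) (f : R -> R).
Local Notation mu := (leb01 R).
Hypothesis f_int : mu.-integrable setT (EFin \o f).

(** The conditions on s' and t' are one-sided: only the loss of a part of ]s, t[ can lower the
    error. *)
Lemma mindev_itv_lsc (s t e : R) : 0 <= s -> t <= 1 -> 0 < e ->
  exists2 r, 0 < r & forall s' t', s' < s + r -> t - r < t' ->
    mindev mu f `]s, t[%classic < mindev mu f `]s', t'[%classic + e.
Proof.
move=> s0 t1 e0; have [ts|st] := leP t s.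
  exists 1 => // s' t' _ _; rewrite set_itv_ge ?bnd_simp -?leNgt//.
  by rewrite mindev_set0 ltr_wpDl// mindev_ge0.
have mitv (x y : R) : measurable (`]x, y[%classic : set (measurableTypeR R)) by [].
(* [Q] is the middle half of ]s, t[. Every ]s', t'[ with ends off by less than [q] contains it,
   which bounds the best constants uniformly. *)
pose q := (t - s) / 4.
have q0 : 0 < q by rewrite divr_gt0// subr_gt0.
pose Q : set R := `]s + q, t - q[%classic.
have Q0 : 0 < fine (mu Q).
  by rewrite leb01_itvoo/= /q; lra.
pose w x := `|f x| + 2 * dev mu f setT 0 / fine (mu Q).
have w0 x : 0 <= w x.
  by rewrite addr_ge0// divr_ge0 ?mulr_ge0 ?dev_ge0// ltW.
have wint : mu.-integrable `]s, t[ (EFin \o w).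
  exact: (integrable_norm_add (leb01_fin R) f_int).
have [r r0 hr] := integral_itv_shrink wint w0 e0.
exists (Num.min r q); first by rewrite lt_min r0 q0.
have mr : Num.min r q <= r by rewrite ge_min lexx.
have mq : Num.min r q <= q by rewrite ge_min lexx orbT.
move: (Num.min r q) mr mq => m mr mq s' t' s'm t'm.
have QB : Q `<=` `]s', t'[.
  by move=> x; rewrite /Q /= !in_itv/= => /andP[h1 h2]; apply/andP; split; lra.
apply: (le_lt_trans
  (mindev_setD (leb01_fin R) f_int (mitv s t) (mitv s' t') (mitv _ _) QB Q0)).
by rewrite ltrD2l; apply: hr => //; lra.
Qed.

End lower_semicontinuity.

(** * Configurations of breakpoints *)

Lemma compact_lsc_min (X : topologicalType) (R : realType) (A : set X)
    (g : X -> R) : compact A -> A !=set0 ->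
  (forall x, A x -> forall e, 0 < e -> \forall y \near x, A y -> g x < g y + e) ->
  exists2 x, A x & forall y, A y -> g x <= g y.
Proof.
move=> cA [a0 Aa0] lscg.
(* The sublevel sets S a form a filter base on A, hence have a cluster point. *)
pose S a := [set y | A y /\ g y <= g a].
pose F := filter_from A S.
have FF : ProperFilter F.
  apply: filter_from_proper; last by move=> a Aa; exists a.
  apply: filter_from_filter; first by exists a0.
  move=> a b Aa Ab; have [ab|ba] := leP (g a) (g b).
  - exists a => // y [Ay ya]; split=> //; split=> //; exact: le_trans ab.
  - exists b => // y [Ay yb]; split=> //; split=> //; exact: le_trans (ltW ba).
have FA : F A by exists a0 => // y [].
have [p [Ap clp]] := cA F FF FA.
(* If g a < g p, semicontinuity with the gap as tolerance gives g > g a on [A] near the cluster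
   point p, although [S a] meets every neighbourhood of p. *)
exists p => // a Aa; rewrite leNgt; apply/negP => gap.
have gpa : 0 < g p - g a by rewrite subr_gt0.
have [|y [[Ay ya] /(_ Ay)]] := clp (S a) _ _ (lscg p Ap _ gpa).
  by exists a.
by rewrite addrC -ltrBlDl opprB addrC subrK ltNge ya.
Qed.

Section knots.
Variable R : realType.
Implicit Types (t : nat -> R) (k i j : nat).

(* k interior breakpoints t 1, .., t k, between t 0 = 0 and t k.+1 = 1; they may
   coincide, which makes the set compact for the product topology. *)
Definition knots k : set (nat -> R) :=
  [set t | [/\ t 0%N = 0, forall i, t i <= t i.+1 & forall i, (k < i)%N -> t i = 1]].

Lemma knots_le k t : knots k t -> {homo t : i j / (i <= j)%N >-> i <= j}.
Proof. by move=> [_ tS _]; exact/nondecreasing_seqP. Qed.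

Lemma knots_itv k t i : knots k t -> 0 <= t i <= 1.
Proof.
move=> kt; have := kt => -[t0 _ t1]; rewrite -{1}t0 (knots_le kt)//=.
by rewrite -(t1 (maxn i k.+1)) ?leq_maxr// (knots_le kt)// leq_maxl.
Qed.

Lemma knots_exists k : knots k !=set0.
Proof.
exists (fun i => (0 < i)%N%:R); split => // [i|i ki].
  by rewrite ler_nat; case: i.
by rewrite (leq_ltn_trans _ ki).
Qed.

(** [bump j] skips the index j. The condition on [t (bump j 0)] matters only for j = 0, where the
    former knot 1 takes the first place and must be 0. *)
Lemma knots_drop k t j : knots k.+1 t -> (j <= k.+1)%N -> t (bump j 0) = 0 ->
  knots k (t \o bump j).
Proof.
move=> kt jk tj; have := kt => -[t0 tS t1]; split => [//|i|i ki] /=.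
- by apply: (knots_le kt); rewrite leq_bump2.
- by apply: t1; rewrite /bump (leq_trans jk ki) add1n ltnS.
Qed.

(** Monotonicity is a closed condition [B] on the product of the compact sets [A i], to which
    Tychonoff's theorem applies. *)
Lemma knots_compact k : compact (knots k : set {ptws nat -> R}).
Proof.
pose A i : set R := if i == 0%N then [set 0] else
  if (i <= k)%N then `[0, 1]%classic else [set 1].
have cA i : compact (A i).
  rewrite /A; case: ifP => _; first exact: compact_set1.
  by case: ifP => _; [exact: segment_compact|exact: compact_set1].
pose B := \bigcap_(i : nat) [set t : {ptws nat -> R} | 0 <= t i.+1 - t i].
have pc i : continuous (fun t : {ptws nat -> R} => t i).
  exact: (@proj_continuous nat (fun=> R) i).
have cB : closed B.
  apply: closed_bigI => i _.
  have : continuous (fun t : {ptws nat -> R} => t i.+1 - t i).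
    by move=> t; exact: (cvgB (pc i.+1 t) (pc i t)).
  by move/continuous_closedP => /(_ _ (@closed_ge R 0)).
have := compact_closedI (tychonoff cA) cB.
congr compact; apply/seteqP; split => t /=.
- move=> [At Bt]; split.
  + exact: (At 0%N).
  + by move=> i; rewrite -subr_ge0; exact: (Bt i).
  + move=> i ki; have := At i; rewrite /A gtn_eqF ?(leq_ltn_trans _ ki)//.
    by rewrite leqNgt ki.
- move=> kt; have := kt => -[t0 tS t1]; split => [i|i _ /=]; last first.
    by rewrite subr_ge0.
  rewrite /A; case: eqP => [->//|_]; case: leqP => [_|ki]; last exact: t1.
  by rewrite /= in_itv/= (knots_itv i kt).
Qed.

(** * Minimizing the total error over the breakpoints and their number *)

Section cost.
Variable E : R -> R -> R.
Hypothesis E_lsc : forall s t e : R, 0 <= s -> t <= 1 -> 0 < e ->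
  exists2 r : R, 0 < r & forall s' t' : R, s' < s + r -> t - r < t' ->
    E s t < E s' t' + e.

Definition cost k t := \sum_(i < k.+1) E (t i) (t i.+1).

(** Each of the k + 1 terms may lose e / (k + 1). Only coordinatewise convergence along the filter
    is needed, as each term depends on two coordinates. *)
Lemma cost_lsc k t e (F : set_system (nat -> R)) : Filter F ->
  (forall i, t' i @[t' --> F] --> t i) -> knots k t -> 0 < e ->
  \forall t' \near F, cost k t < cost k t' + e.
Proof.
move=> FF Ft kt e0; pose d := e / k.+1%:R.
have d0 : 0 < d by rewrite divr_gt0.
have near_i (i : 'I_k.+1) : \forall t' \near F,
    E (t i) (t i.+1) < E (t' (nat_of_ord i)) (t' i.+1) + d.
  have /andP[ti0 _] := knots_itv i kt; have /andP[_ ti1] := knots_itv i.+1 kt.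
  have [r r0 hr] := E_lsc ti0 ti1 d0.
  have near_lt : \forall t' \near F, t' (nat_of_ord i) < t i + r.
    by apply: (cvgr_lt (t i) (Ft i)); rewrite ltrDl.
  have near_gt : \forall t' \near F, t i.+1 - r < t' i.+1.
    by apply: (cvgr_gt (t i.+1) (Ft i.+1)); rewrite gtrBl.
  by apply: filterS2 near_lt near_gt => t'; exact: hr.
have := filter_forall FF near_i; apply: filterS => t' tt'.
have -> : e = \sum_(i < k.+1) d.
  by rewrite sumr_const card_ord -mulr_natr divfK.
by rewrite /cost -big_split/=; apply: ltr_sum => //; apply/hasP; exists ord0; rewrite ?mem_index_enum.
Qed.

Lemma cost_min k : exists2 t, knots k t & forall t', knots k t' ->
  cost k t <= cost k t'.
Proof.
apply: (compact_lsc_min (@knots_compact k) (knots_exists k)) => t kt e e0.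
have Ft i : t' i @[t' --> nbhs (t : {ptws nat -> R})] --> t i.
  exact: (@proj_continuous nat (fun=> R) i).
have := cost_lsc (nbhs_filter (t : {ptws nat -> R})) Ft kt e0.
by apply: (@filterS _ _ (nbhs_filter (t : {ptws nat -> R}))) => t' h _.
Qed.

Hypothesis E_ge0 : forall s t : R, 0 <= E s t.
Hypothesis E_refl : forall s, E s s = 0.

Lemma cost_drop k t j : (j <= k.+1)%N -> t j = t j.+1 ->
  cost k.+1 t = cost k (t \o bump j).
Proof.
move=> jk tj; pose J := Ordinal (jk : (j < k.+2)%N).
rewrite /cost (bigD1_ord J)//= -tj E_refl add0r; apply: eq_bigr => i _ /=.
congr (E _ _); rewrite /bump.
have [ji|ij] := leqP j i; first by rewrite (leqW ji).
(* The piece ending at the dropped knot j now ends at knot j + 1, which is the same point. *)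
have [jE|jSi] := eqVneq j i.+1; first by rewrite -jE leqnn.
by rewrite leq_eqVlt (negbTE jSi)/= ltnS leqNgt ij.
Qed.

Lemma penalized_cost_min (gamma : R) : 0 < gamma -> exists k t,
  [/\ knots k t, forall i, (i <= k)%N -> t i < t i.+1 &
   forall k' t', knots k' t' ->
     gamma * k%:R + cost k t <= gamma * k'%:R + cost k' t'].
Proof.
move=> g0.
have /choice[u hu] k : exists t, knots k t /\
    forall t', knots k t' -> cost k t <= cost k t'.
  by have [t kt tmin] := cost_min k; exists t.
have cost_ge0 k t : 0 <= cost k t by apply: sumr_ge0.
pose a k := gamma * k%:R + cost k (u k).
have [k ka] : exists k, forall k', a k <= a k'.
  (* For k' > N the penalty alone is at least [a 0], so the least of [a 0], ..., [a N] is a global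
     minimum. *)
  have [N aN] : exists N : nat, a 0%N <= gamma * N%:R.
    exists (Num.truncn (a 0%N / gamma)).+1.
    by rewrite mulrC -ler_pdivrMr// ltW// truncnS_gt.
  have [/= k _ kmin] := arg_minP (fun i : 'I_N.+1 => a i) (erefl : predT (@ord0 N)).
  exists k => k'; have [k'N|Nk'] := ltnP k' N.+1.
    exact: (kmin (Ordinal k'N)).
  apply: (le_trans (kmin ord0 isT)); apply: (le_trans aN).
  by rewrite /a ler_wpDr// ler_wpM2l ?(ltW g0)// ler_nat ltnW.
exists k, (u k); have [kuk ukmin] := hu k.
split => // [i ik|k' t' kt']; last first.
  by apply: (le_trans (ka k')); rewrite lerD2l; exact: (hu k').2.
have [u0 uS u1] := kuk; rewrite lt_neqAle uS andbT; apply/eqP => ui.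
(* With no interior breakpoint, a coincidence would mean 0 = 1. *)
case: k ka kuk ukmin ik u0 uS u1 ui => [|k] ka kuk _ ik u0 _ u1 ui.
  move: ik ui; rewrite leqn0 => /eqP ->; rewrite u0 u1// => /eqP.
  by rewrite eq_sym oner_eq0.
have := ka k; rewrite /a (cost_drop ik ui) => /le_trans h.
(* Dropping a repeated breakpoint would save gamma. *)
have uj0 : u k.+1 (bump i 0) = 0.
  by rewrite /bump leqn0; case: eqP => // i0; rewrite -u0 -[X in _ = u _ X]i0 ui i0.
have := h _ (lerD (lexx _) ((hu k).2 _ (knots_drop kuk ik uj0))).
by rewrite lerD2r ler_pM2l// ler_nat ltnn.
Qed.

End cost.
End knots.

(** * Counting measure and integrable representatives of classes *)

Lemma counting_le (T : choiceType) (R : realType) (A : set T) (s : seq T) :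
  A `<=` [set` s] -> (counting A <= (size s)%:R%:E :> \bar R)%E.
Proof.
move=> As; have fA : finite_set A by apply: sub_finite_set As _; exact: finite_seq.
rewrite /counting asboolT// lee_fin ler_nat.
apply: (@leq_trans #|` [fset x in s]%fset|).
  apply/fsubset_leq_card/fsubsetP => x; rewrite in_fset_set// => /set_mem /As /= xs.
  by rewrite inE.
by rewrite card_fseq size_undup.
Qed.

Lemma counting_ge (T : choiceType) (R : realType) (A : set T) (s : seq T) :
  uniq s -> [set` s] `<=` A -> ((size s)%:R%:E <= counting A :> \bar R)%E.
Proof.
move=> us sA; rewrite /counting; case: asboolP => [fA|_]; last exact: leey.
rewrite lee_fin ler_nat -(undup_id us) -card_fseq.
apply/fsubset_leq_card/fsubsetP => x; rewrite inE => xs.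
by rewrite in_fset_set//; apply/mem_set/sA.
Qed.

Section L1_class.
Context d (T : measurableType d) (R : realType).
Variable mu : {measure set T -> \bar R}.

Lemma aeEqMfun_measurable (u : {mfun_ mu, T >-> measurableTypeR R}) :
  measurable_fun setT (u : T -> R).
Proof. exact: (@measurable_funPT _ _ T (measurableTypeR R) (repr u)). Qed.

Lemma L1_integrable (u : LspaceType1 mu) : mu.-integrable setT (EFin \o u).
Proof.
apply/integrableP; split; first exact/measurable_EFinP/aeEqMfun_measurable.
by have := @Lebesgue_finite _ _ _ _ _ _ u; rewrite /finite_norm Lnorm1.
Qed.

(** Turns an explicit function, later the step function with the best constants, into an element of
    the space of classes. *)
Lemma L1_of_integrable (g : T -> R) : mu.-integrable setT (EFin \o g) ->
  exists u : LspaceType1 mu, u = g %[ae mu].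
Proof.
move=> gint.
have mg : measurable_fun setT g by exact/measurable_EFinP/(measurable_int mu).
pose gM : {mfun T >-> measurableTypeR R} :=
  HB.pack_for {mfun T >-> measurableTypeR R} g 
    (isMeasurableFun.Build _ _ T (measurableTypeR R) g mg).
pose v : {mfun_ mu, T >-> measurableTypeR R} := (\pi gM)%qT.
have vg : (v : T -> R) = g %[ae mu].
  suff /asboolP : ae_eq_op mu (repr v) gM by [].
  by rewrite -eqmodE reprK.
have vfin : finite_norm mu 1 v.
  rewrite /finite_norm Lnorm1.
  have /integrableP[_] := gint; congr (_ < _)%E.
  apply: ge0_ae_eq_integral => //.
  - by apply: measurableT_comp => //; exact/measurable_EFinP.
  - by apply: measurableT_comp => //; apply/measurable_EFinP; exact: aeEqMfun_measurable.
  - by apply: filterS vg => x /(_ I) /= ->.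
pose u : LspaceType1 mu := HB.pack_for (LspaceType1 mu) v
  (isFinLebesgue.Build _ _ _ mu _ (@lexx _ _ 1%E) v vfin).
by exists u.
Qed.

End L1_class.

(** * Integrals over [0,1] split at the breakpoints *)

Section leb01_knots.
Variable R : realType.
Local Notation mu := (leb01 R).

Lemma leb01_aeS (P Q : R -> Prop) : (forall x, P x -> Q x) ->
  {ae mu, forall x, P x} -> {ae mu, forall x, Q x}.
Proof. by move=> PQ; apply: (filterS (Filter := ae_filter_ringOfSetsType mu)). Qed.

Lemma leb01_aeS2 (P P' Q : R -> Prop) : (forall x, P x -> P' x -> Q x) ->
  {ae mu, forall x, P x} -> {ae mu, forall x, P' x} -> {ae mu, forall x, Q x}.
Proof. by move=> PQ; apply: (@filterS2 _ _ (ae_filter_ringOfSetsType mu)). Qed.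

Lemma leb01_ae_exists (p q : R) (P : R -> Prop) : 0 <= p -> p < q -> q <= 1 ->
  {ae mu, forall y, P y} -> exists2 y, p < y < q & P y.
Proof.
move=> p0 pq q1 Pae; apply: contrapT => noP.
suff : mu `]p, q[%classic = 0%E.
  by rewrite leb01_itvoo// => /eqP; apply/negP; rewrite eqe subr_eq0 gt_eqF.
apply/negligibleP; first exact: measurable_itv.
apply: negligibleS Pae => y /=; rewrite in_itv/= => ypq Py.
by apply: noP; exists y.
Qed.

Lemma integral_knots (h : R -> \bar R) k t :
  measurable_fun (setT : set (measurableTypeR R)) h -> (forall x, 0 <= h x)%E ->
  knots k t ->
  (\int[mu]_x h x = \sum_(i < k.+1) \int[mu]_(x in `]t i, t i.+1[%classic) h x)%E.
Proof.
move=> mh h0 kt; have := kt => -[t0 tS t1].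
have nu1 := @leb01_set1 R.
have nul : mu `]-oo, 0]%classic = 0%E.
  apply: leb01_out; first exact: measurable_itv.
  apply/seteqP; split => x //=.
  by rewrite !in_itv/= => -[x0 /andP[/lt_le_trans /(_ x0)]]; rewrite ltxx.
have nur : mu `]1, +oo[%classic = 0%E.
  apply: leb01_out; first exact: measurable_itv.
  apply/seteqP; split => x //=.
  by rewrite !in_itv/= andbT => -[/lt_trans x1 /andP[_ /x1]]; rewrite ltxx.
(* From here on the measure enters only through three facts: points, ]-oo, 0] and [1, +oo[ are
   null. *)
move: (leb01 R) nu1 nul nur => nu nu1 nul nur.
have mhA (A : set (measurableTypeR R)) : measurable_fun A h.
  exact: measurable_funS mh.
(* Induction on half-lines closed on the right: each step adds ]t m, t m.+1], whose right end is
   null. *)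
have part m : (\int[nu]_(x in `]-oo, t m]%classic) h x =
    \sum_(i < m) \int[nu]_(x in `]t i, t i.+1[%classic) h x)%E.
  elim: m => [|m IHm].
    by rewrite big_ord0 t0; apply: null_set_integral.
  rewrite big_ord_recr -IHm/=.
  have -> : `]-oo, t m.+1]%classic = `]-oo, t m] `|` `]t m, t m.+1].
    by rewrite -itv_bndbnd_setU//= bnd_simp.
  rewrite ge0_integral_setU//; last first.
    by apply/disj_setPS => x /=; rewrite !in_itv/= => -[xm /andP[]]; rewrite ltNge xm.
  congr (_ + _)%E.
  rewrite (_ : `]t m, t m.+1[%classic = `]t m, t m.+1] `\` [set t m.+1]).
    by apply: ge0_negligible_integral => //; exact: nu1.
  apply/seteqP; split => x /=; rewrite !in_itv/=.
    by move=> /andP[-> xt]; rewrite ltW//; split => // xE; move: xt; rewrite xE ltxx.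
  by move=> [/andP[-> xt] /eqP xn] /=; rewrite lt_neqAle xn.
rewrite -part (t1 k.+1)//.
rewrite (_ : `]-oo, 1]%classic = setT `\` `]1, +oo[).
  by apply: ge0_negligible_integral => //; exact: nur.
apply/seteqP; split => x /=; rewrite !in_itv/= ?andbT.
  by move=> x1; split => //; apply/negP; rewrite -leNgt.
by move=> [_ /negP]; rewrite -leNgt.
Qed.

Lemma Lnorm_knots (f u : L1 R) k t (c : nat -> R) : knots k t ->
  (forall i, (i <= k)%N -> {ae mu, forall x, t i < x < t i.+1 -> u x = c i}) ->
  'N[mu]_1[EFin \o (u \- f)%R]%E =
    (\sum_(i < k.+1) dev mu f `]t i, t i.+1[%classic (c i))%:E.
Proof.
move=> kt uc.
have mu_ : measurable_fun (setT : set (measurableTypeR R)) (u \- f).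
  by apply: measurable_funB; exact: aeEqMfun_measurable.
rewrite Lnorm1 (integral_knots _ _ kt) => [|//|x]; last first.
- exact: abse_ge0.
- by apply: measurableT_comp => //; exact/measurable_EFinP.
rewrite -sumEFin; apply: eq_bigr => i _.
have dint := integrable_dev (leb01_fin R) (L1_integrable f) (c i)
  (measurable_itv `]t i, t i.+1[).
rewrite /dev /Rintegral fineK; last exact: integrable_fin_num.
apply: ge0_ae_eq_integral => //.
- apply: measurableT_comp => //; apply/measurable_EFinP.
  exact: measurable_funS mu_.
- exact: measurable_int dint.
- apply: leb01_aeS (uc i (ltn_ord i)) => x h /=; rewrite in_itv/= => xi.
  by rewrite h// distrC.
Qed.

End leb01_knots.

(** * Comparison with the Potts functional *)

Section potts_knots.
Variables (R : realType) (gamma : R) (f : L1 R).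
Hypothesis gamma_gt0 : 0 < gamma.
Local Notation mu := (leb01 R).

Let E (s t : R) : R := mindev mu f `]s, t[%classic.

Lemma knots_lt k (t : nat -> R) : knots k t ->
  (forall i, (i <= k)%N -> t i < t i.+1) ->
  forall i j, (i < j)%N -> (j <= k.+1)%N -> t i < t j.
Proof.
move=> kt tlt i j ij jk; apply: (@lt_le_trans _ _ (t i.+1)).
  by apply: tlt; rewrite -ltnS (leq_trans ij).
exact: (knots_le kt).
Qed.

(** Take the largest i with t i <= x. It exists because t 0 = 0 and all knots beyond k equal 1. *)
Lemma knots_locate k (t : nat -> R) x : knots k t -> 0 <= x < 1 ->
  exists2 i, (i <= k)%N & t i <= x < t i.+1.
Proof.
move=> [t0 _ t1] /andP[x0 x1].
have exi : exists i, t i <= x by exists 0%N; rewrite t0.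
have bnd i : t i <= x -> (i <= k)%N.
  by move=> tix; rewrite leqNgt; apply/negP => /t1 ti1; move: tix; rewrite ti1 leNgt x1.
have [i tix imax] := ex_maxnP exi bnd.
exists i; first exact: bnd.
by rewrite tix ltNge; apply/negP => /imax; rewrite ltnn.
Qed.

Lemma knots_piecewise_constant k (t : nat -> R) (g : R -> R) (c : nat -> R) :
  knots k t -> (forall i, (i <= k)%N -> t i < t i.+1) ->
  (forall i x, (i <= k)%N -> t i < x < t i.+1 -> g x = c i) ->
  piecewise_constant g.
Proof.
move=> kt tlt gc; have := kt => -[t0 tS t1].
(* A list in [itv_partition] omits the left endpoint 0 and ends with 1. *)
pose s := mkseq (t \o S) k.+1.
have nthS i : (i < k.+1)%N -> nth 0 s i = t i.+1 by move=> ik; rewrite nth_mkseq.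
have nth0S i : (i < k.+2)%N -> nth 0 (0 :: s) i = t i.
  by case: i => [|i] ik /=; [rewrite t0|exact: nthS].
exists s.
  split; last by rewrite (last_nth 0) size_mkseq nth0S// t1.
  apply/(pathP 0) => i; rewrite size_mkseq => ik.
  by rewrite nth0S ?(leqW ik)// nthS//; exact: tlt.
move=> i; rewrite size_mkseq => ik; exists (c i) => x.
by rewrite nth0S ?(leqW ik)// nthS//; exact: gc.
Qed.

(** A point of ]0, 1[ that is not a knot lies inside an open piece. There u is a.e. equal to [c i]
    on both sides, so the two constants a and b agree. *)
Lemma jump_set_knots (u : L1 R) k (t : nat -> R) (c : nat -> R) : knots k t ->
  (forall i, (i <= k)%N -> {ae mu, forall x, t i < x < t i.+1 -> u x = c i}) ->
  jump_set u `<=` [set` mkseq (t \o S) k].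
Proof.
move=> kt uc x [/andP[x0 x1] [a [b [ab [e e0 [ua ub]]]]]].
have [|i ik /andP[tix xti]] := knots_locate kt (x := x); first by rewrite ltW.
have [xE|xti0] := eqVneq x (t i).
  case: i ik tix xti xE => [|i] ik _ _ xE.
    by move: x0; have [t0 _ _] := kt; rewrite xE t0 ltxx.
  by rewrite /= xE; apply: (map_f (t \o S)); rewrite mem_iota.
have {}tix : t i < x by rewrite lt_neqAle eq_sym xti0.
have /andP[ti0 _] := knots_itv i kt; have /andP[_ ti1] := knots_itv i.+1 kt.
case/negP: ab; apply/eqP.
have -> : a = c i.
  have [||y /andP[+ yx] [uya uyc]] :=
      leb01_ae_exists (p := Num.max (x - e) (t i)) (q := x) _ _ (ltW x1)
        (leb01_aeS2 (fun y => @conj _ _) ua (uc i ik)).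
  - by rewrite le_max ti0 orbT.
  - by rewrite gt_max tix gtrBl e0.
  - rewrite gt_max => /andP[xey ty].
    by rewrite -uya ?xey// uyc// ty (lt_trans yx).
have [||y /andP[xy +] [uyb uyc]] :=
    leb01_ae_exists (q := Num.min (x + e) (t i.+1)) (p := x) (ltW x0) _ _
      (leb01_aeS2 (fun y => @conj _ _) ub (uc i ik)).
- by rewrite lt_min xti ltrDl e0.
- by rewrite ge_min ti1 orbT.
- rewrite lt_min => /andP[yxe yt].
  by rewrite -uyb ?xy// uyc// yt (lt_trans tix).
Qed.

(** Put the best constant on each piece. Only an inequality holds, since neighbouring best constants
    may coincide and then the breakpoint is no jump. *)
Lemma potts_le_cost k (t : nat -> R) : knots k t ->
  (forall i, (i <= k)%N -> t i < t i.+1) ->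
  exists u : L1 R, (potts gamma f u <= (gamma * k%:R + cost E k t)%:E)%E.
Proof.
move=> kt tlt.
pose A i : set (measurableTypeR R) := `]t i, t i.+1[%classic.
pose c i := best mu f (A i).
pose g x := \sum_(i < k.+1) c i * \1_(A i) x.
have gc i x : (i <= k)%N -> t i < x < t i.+1 -> g x = c i.
  move=> ik xi; rewrite /g (bigD1 (Ordinal (ik : (i < k.+1)%N)))//= big1 => [|j ji].
    by rewrite indicE mem_set ?mulr1 ?addr0// /A /= in_itv.
  rewrite indicE memNset ?mulr0// /A /= in_itv/= => /andP[tjx xtj].
  have /andP[tix xti] := xi.
  have /negP := ji; apply; apply/eqP/val_inj => /=; apply/eqP.
  rewrite eqn_leq; apply/andP; split; rewrite leqNgt; apply/negP => h.
  - by have := knots_le kt h; rewrite leNgt (lt_trans tjx).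
  - by have := knots_le kt h; rewrite leNgt (lt_trans tix).
have gint : mu.-integrable setT (EFin \o g).
  have : mu.-integrable setT (fun x => \sum_(i < k.+1) (c i * \1_(A i) x)%:E)%E.
    apply: integrable_sum => // i _.
    apply: measurable_bounded_integrable => //; first exact: leb01_fin.
    - by apply: measurable_funM => //; apply: measurable_indic; exact: measurable_itv.
    - exists `|c i|; split; first exact: num_real.
      move=> M cM x _ /=; rewrite normrM indicE; apply: le_trans (ltW cM).
      by case: (_ \in _); rewrite ?normr1 ?normr0 ?mulr1// mulr0.
  by apply: eq_integrable => // x _; rewrite /= /g sumEFin.
have [u ug] := L1_of_integrable gint.
have uc i : (i <= k)%N -> {ae mu, forall x, t i < x < t i.+1 -> u x = c i}.
  by move=> ik; apply: leb01_aeS ug => x /(_ I) -> xi; exact: gc.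
exists u; rewrite /potts asboolT; last first.
  by exists g => //; exact: knots_piecewise_constant kt tlt gc.
rewrite (Lnorm_knots f kt uc) EFinD; apply: leeD => //.
rewrite EFinM lee_pmul2l//.
have := counting_le R (jump_set_knots kt uc).
by rewrite size_mkseq.
Qed.

(** Breakpoints need not be jumps, so k is not determined by u; its least value is the number of
    jumps. *)
Definition knotted (u : L1 R) k := exists (t c : nat -> R),
  [/\ knots k t, forall i, (i <= k)%N -> t i < t i.+1 &
   forall i, (i <= k)%N -> {ae mu, forall x, t i < x < t i.+1 -> u x = c i}].

Lemma PC_knotted (u : L1 R) : PC u -> exists k, knotted u k.
Proof.
move=> [g [s [/(pathP 0) sp /eqP slast] gs] ug].
(* The default 1 makes t constantly 1 past the end of the list, as [knots] demands;
   [piecewise_constant] uses the default 0, hence the changes of default below. *)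
pose t := nth 1 (0 :: s).
have ts i : (i < size s)%N -> t i < t i.+1.
  move=> si; rewrite /t (set_nth_default 0) ?(leqW si)//.
  by rewrite [X in _ < X](set_nth_default 0)//; exact: sp.
have t1 i : (size s <= i)%N -> t i = 1.
  rewrite leq_eqVlt => /predU1P[<-|si]; last by rewrite /t nth_default.
  by rewrite -slast (last_nth 1).
have s0 : (0 < size s)%N.
  by case: s slast {sp gs t ts t1} => //= /eqP; rewrite eq_sym oner_eq0.
have [c hc] : exists c : nat -> R, forall i, (i < size s)%N ->
    forall x, t i < x < t i.+1 -> g x = c i.
  have : forall i, exists c : R, (i < size s)%N ->
      forall x, t i < x < t i.+1 -> g x = c.
    move=> i; have [si|si] := ltnP i (size s); last by exists 0.
    have [c hc] := gs i si; exists c => _ x xi; apply: hc.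
    rewrite (set_nth_default 1) ?(leqW si)//.
    by rewrite [X in _ < _ < X](set_nth_default 1).
  by move=> /choice[c hc]; exists c.
exists (size s).-1, t, c; split.
- split => // i; last by rewrite prednK//; exact: t1.
  have [si|si] := ltnP i (size s); first exact/ltW/ts.
  by rewrite (t1 i si) (t1 i.+1 (leqW si)).
- by move=> i; rewrite -ltnS prednK//; exact: ts.
- move=> i; rewrite -ltnS prednK// => si.
  by apply: leb01_aeS ug => x /(_ I) -> xi; exact: hc.
Qed.

Lemma knotted_merge (u : L1 R) k (t c : nat -> R) j : knots k.+1 t ->
  (forall i, (i <= k.+1)%N -> t i < t i.+1) ->
  (forall i, (i <= k.+1)%N -> {ae mu, forall x, t i < x < t i.+1 -> u x = c i}) ->
  (j <= k)%N -> c j = c j.+1 -> knotted u k.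
Proof.
move=> kt tlt uc jk cj; exists (t \o bump j.+1), (c \o bump j.+1).
split => [|i ik|i ik] /=.
- by apply: (knots_drop kt) => //; have [] := kt.
- apply: (knots_lt kt tlt); first by rewrite ltnNge leq_bump2 -ltnNge.
  by rewrite /bump; case: (j < i.+1)%N; [rewrite add1n !ltnS|exact: leqW].
(* Pieces before j are unchanged and pieces after j are shifted by one. Piece j becomes ]t j, t
   j.+2[, where the removed knot is a null set. *)
- have [ij|ji|ij] := ltngtP i j.
  + have -> : bump j.+1 i = i by rewrite /bump leqNgt ltnW.
    have -> : bump j.+1 i.+1 = i.+1 by rewrite /bump ltnS leqNgt ij.
    by apply: uc; rewrite leqW.
  + have -> : bump j.+1 i = i.+1 by rewrite /bump ji.
    have -> : bump j.+1 i.+1 = i.+2 by rewrite /bump leqW.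
    exact: uc.
  + have -> : bump j.+1 i = j by rewrite /bump ij ltnn.
    have -> : bump j.+1 i.+1 = j.+2 by rewrite /bump ij leqnn.
    have tj : {ae mu, forall x, x != t j.+1}.
      exists [set t j.+1]; split => //; first exact: leb01_set1.
      by move=> x /= /negP/negPn/eqP.
    have uj : {ae mu, forall x, t j.+1 < x < t j.+2 -> u x = c j}.
      by rewrite cj; exact: uc.
    have := leb01_aeS2 (fun x => @conj _ _) tj (uc j (leqW jk)).
    apply: leb01_aeS2 uj => x ujx [xt hx] /andP[tjx xtj].
    have [xtS|tSx] := ltP x (t j.+1); first by apply: hx; rewrite tjx.
    by apply: ujx; rewrite xtj lt_neqAle eq_sym xt tSx.
Qed.

Lemma cost_le_potts (u : L1 R) : PC u -> exists k t,
  knots k t /\ ((gamma * k%:R + cost E k t)%:E <= potts gamma f u)%E.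
Proof.
move=> uPC.
(* With as few pieces as possible, adjacent values differ, so that every interior
   breakpoint is a jump. *)
have exk : exists k, `[< knotted u k >].
  by have [k uk] := PC_knotted uPC; exists k; exact/asboolP.
have [k /asboolP[t [c [kt tlt uc]]] kmin] := ex_minnP exk.
exists k, t; split => //.
rewrite /potts asboolT// (Lnorm_knots f kt uc) EFinD; apply: leeD; last first.
  rewrite lee_fin; apply: ler_sum => i _; apply: mindev_le => //.
  - exact: leb01_fin.
  - exact: L1_integrable.
rewrite EFinM lee_pmul2l//.
rewrite -[k in k%:R](size_mkseq (t \o S)); apply: counting_ge.
  apply/mkseq_uniqP => i j; rewrite !inE => ik jk /= tij.
  have [ij|ji|//] := ltngtP i j; exfalso.
    by have := knots_lt kt tlt (ij : (i.+1 < j.+1)%N) (leqW jk); rewrite tij ltxx.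
  by have := knots_lt kt tlt (ji : (j.+1 < i.+1)%N) (leqW ik); rewrite tij ltxx.
move=> x /= /mapP[j]; rewrite mem_iota add0n => /= jk ->.
have t0j : 0 < t j.+1.
  by have [<- _ _] := kt; apply: (knots_lt kt tlt) => //; exact: leqW.
have tj1 : t j.+1 < 1.
  by have [_ _ t1] := kt; rewrite -(t1 k.+1)//; exact: (knots_lt kt tlt).
split; first by rewrite t0j.
exists (c j), (c j.+1); split.
  (* Equal neighbouring values would allow a merge, against the minimality of k. *)
  apply/eqP => cj; case: k jk kt tlt uc kmin => // k jk kt tlt uc kmin.
  have /asboolP/kmin := knotted_merge kt tlt uc jk cj.
  by rewrite ltnn.
have jj := tlt j (ltnW jk); have jj1 := tlt j.+1 jk.
(* The shorter of the two adjacent pieces, so that both one-sided neighbourhoods stay inside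
   them. *)
exists (Num.min (t j.+1 - t j) (t j.+2 - t j.+1)).
  by rewrite lt_min !subr_gt0 jj.
split.
- apply: leb01_aeS (uc j (ltnW jk)) => y h /andP[xl xr]; apply: h.
  rewrite xr andbT; apply: le_lt_trans xl.
  by rewrite lerBrDl -lerBrDr ge_min lexx.
- apply: leb01_aeS (uc j.+1 jk) => y h /andP[xl xr]; apply: h.
  rewrite xl; apply: (lt_le_trans xr).
  by rewrite -lerBrDl ge_min lexx orbT.
Qed.

End potts_knots.

Theorem theorem2p8 (R : realType) (f : L1 R) (gamma : R) (hgamma : 0 < gamma) :
  exists u : L1 R,
    potts gamma f u = ereal_inf [set potts gamma f v | v in [set: L1 R]].
Proof.
pose E (s t : R) := mindev (leb01 R) f `]s, t[%classic.
have E_lsc (s t e : R) : 0 <= s -> t <= 1 -> 0 < e ->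
    exists2 r : R, 0 < r & forall s' t' : R, s' < s + r -> t - r < t' ->
      E s t < E s' t' + e.
  by move=> s0 t1 e0; exact: (mindev_itv_lsc (L1_integrable f)).

have E_ge0 (s t : R) : 0 <= E s t by exact: mindev_ge0.
have E_refl (s : R) : E s s = 0 by rewrite /E set_itvoo0 mindev_set0.
have [k [t [kt tlt tmin]]] := penalized_cost_min E_lsc E_ge0 E_refl hgamma.
have [u uE] := potts_le_cost f hgamma kt tlt.
exists u; apply/eqP; rewrite eq_le; apply/andP; split; last first.
  by apply: ereal_inf_lbound; exists u.
apply: le_ereal_inf_tmp => _ [v _ <-].
(* For v in PC: potts of u <= least penalized cost <= penalized cost of the breakpoints of v <=
   potts of v. *)
have [vPC|nvPC] := pselect (PC v); last by rewrite {2}/potts asboolF// leey.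
have [k' [t' [kt' vE]]] := cost_le_potts f hgamma vPC.
apply: (le_trans uE); apply: le_trans vE.
by rewrite lee_fin tmin.
Qed.
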